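(* Let $K$ be a field with ${\rm char}(K) = 0$ and let $n > 3$ be an integer. Then $A({\tt vdw}(n,3)) = K[x_1,\ldots,x_n]/(I_{{\tt vdw}(n,3)} + \langle x_1^2,\ldots,x_n^2\rangle)$ has the WLP if and only if $n = 4, 5$, or $6$.
   Context: For integers $n > k \geq 1$, the van der Waerden complex ${\tt vdw}(n,k)$ is the simplicial complex on the vertex set $\{x_1,\ldots,x_n\}$ whose facets are exactly the sets $\{x_i, x_{i+d}, x_{i+2d}, \ldots, x_{i+kd}\}$ with $i \geq 1$, $d \geq 1$ integers and $i+kd \leq n$ (arithmetic progressions with $k$ steps, i.e. $k+1$ elements, in $\{1,\ldots,n\}$). The Stanley-Reisner ideal $I_\Delta \subseteq K[x_1,\ldots,x_n]$ of a simplicial complex $\Delta$ on $\{x_1,\ldots,x_n\}$ is the ideal generated by the squarefree monomials $x_{i_1}\cdots x_{i_t}$ with $\{x_{i_1},\ldots,x_{i_t}\} \notin \Delta$. Let $A = \bigoplus_{i \geq 0} A_i$ be a standard graded Artinian quotient of $K[x_1,\ldots,x_n]$ by a homogeneous ideal. A linear map between finite-dimensional vector spaces has maximal rank if it is injective or surjective. $A$ has the Weak Lefschetz Property (WLP) if for a general linear form $\ell$ (i.e. for all $\ell$ in some nonempty Zariski-open subset of the space of linear forms) the multiplication map $\times\ell: A_i \to A_{i+1}$ has maximal rank for all $i \geq 0$. *)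

(* Defs.v *)
From HB Require Import structures.
From mathcomp Require Import all_boot all_order all_algebra.
From mathcomp Require Import generic_quotient ring_quotient.
From mathcomp Require Import boolp classical_sets functions.
From mathcomp Require Import mpoly.

Set Implicit Arguments.
Unset Strict Implicit.
Unset Printing Implicit Defensive.

Import GRing.Theory.

Local Open Scope ring_scope.
Local Open Scope quotient_scope.
Local Open Scope classical_set_scope.

(* Throughout, the variables x_1, ..., x_n are 'X_v for v : 'I_n, so that the
   index v stands for the vertex x_(v+1). *)

Record simplicial_complex (n : nat) := SimplicialComplex {
  faces : {set {set 'I_n}};
  faces0 : finset.set0 \in faces;
  faces_sub : forall F G : {set 'I_n},
    G \in faces -> F \subset G -> F \in faces }.

Definition progression (n k i d : nat) : {set 'I_n} :=
  [set v : 'I_n | [exists j : 'I_k.+1, v == i + j * d :> nat]%N]%SET.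

(* Taking d < n loses nothing: i + k * d < n and k >= 1 imply it. *)
Definition vdw_facets (n k : nat) : {set {set 'I_n}} :=
  [set G | [exists i : 'I_n, exists d : 'I_n,
     [&& 0 < d, i + k * d < n & G == progression n k i d]]]%N%SET.

Definition vdw_faces (n k : nat) : {set {set 'I_n}} :=
  [set F : {set 'I_n} | [exists G in vdw_facets n k, F \subset G]]%SET.

Lemma vdw_faces0 (n k : nat) : (0 < k < n)%N ->
  finset.set0 \in vdw_faces n k.
Proof.
move=> /andP[k0 kn]; rewrite inE; apply/exists_inP.
have n0 : (0 < n)%N by apply: leq_ltn_trans kn.
have n1 : (1 < n)%N by apply: leq_ltn_trans kn.
exists (progression n k 0 1); last exact: finset.sub0set.
rewrite inE; apply/existsP; exists (Ordinal n0).
by apply/existsP; exists (Ordinal n1); rewrite /= muln1 kn eqxx.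
Qed.

Lemma vdw_faces_sub (n k : nat) (F G : {set 'I_n}) :
  G \in vdw_faces n k -> F \subset G -> F \in vdw_faces n k.
Proof.
rewrite !inE => /exists_inP[H HH GH] FG; apply/exists_inP.
by exists H => //; apply: (fintype.subset_trans FG).
Qed.

Definition vdw (n k : nat) (hk : (0 < k < n)%N) : simplicial_complex n :=
  SimplicialComplex (vdw_faces0 hk) (@vdw_faces_sub n k).

Section Ideals.
Variable R : comNzRingType.
Implicit Types (G I J : set R).

Definition ideal_gen G : set R :=
  [set f | exists2 s : seq (R * R),
     (forall p, p \in s -> G p.2) & f = \sum_(p <- s) p.1 * p.2].

Definition ideal_add I J : set R :=
  [set f | exists g, exists2 h, I g /\ J h & f = g + h].

Lemma ideal_gen0 G : ideal_gen G 0.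
Proof. by exists [::]; rewrite ?big_nil. Qed.

Lemma ideal_gen_lin G a u v :
  ideal_gen G u -> ideal_gen G v -> ideal_gen G (a * u + v).
Proof.
move=> [s sG ->] [t tG ->].
exists ([seq (a * p.1, p.2) | p <- s] ++ t) => [p|].
  by rewrite mem_cat => /orP[/mapP[q /sG Gq ->]|/tG].
rewrite big_cat big_map mulr_sumr /=; congr (_ + _).
by apply: eq_bigr => p _; rewrite mulrA.
Qed.

Lemma ideal_gen_ker (S : comNzRingType) (e : {rmorphism R -> S}) G f :
  (forall g, G g -> e g = 0) -> ideal_gen G f -> e f = 0.
Proof.
move=> eG [s sG ->]; rewrite rmorph_sum big_seq big1 // => p ps.
by rewrite rmorphM (eG _ (sG _ ps)) mulr0.
Qed.

End Ideals.

Section ArtinianAlgebra.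
Variables (K : fieldType) (n : nat) (D : simplicial_complex n).

Definition stanley_reisner_ideal : set {mpoly K[n]} :=
  ideal_gen [set f | exists2 F : {set 'I_n}, F \notin faces D
                                            & f = \prod_(v in F) 'X_v].

Definition squares_ideal : set {mpoly K[n]} :=
  ideal_gen [set f | exists v : 'I_n, f = 'X_v ^+ 2].

(* A(D) is the quotient of {mpoly K[n]} by this ideal. *)
Definition A_ideal : {pred {mpoly K[n]}} :=
  fun f => `[< ideal_add stanley_reisner_ideal squares_ideal f >].

Lemma A_ideal_closed : idealr_closed A_ideal.
Proof.
split.
- by apply/asboolP; exists 0, 0; [split; apply: ideal_gen0 | rewrite addr0].
- apply/asboolP => -[g [h [Ig Jh]]] /(congr1 (meval (fun=> 0 : K))).
  rewrite rmorphD rmorph1 /= (ideal_gen_ker _ Ig) ?(ideal_gen_ker _ Jh).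
  + by move/eqP; rewrite addr0 oner_eq0.
  + by move=> _ [v ->]; rewrite rmorphXn /= mevalXU expr0n.
  + move=> _ [F FD ->]; rewrite rmorph_prod /=.
    have [F0|[v vF]] := set_0Vmem F; first by rewrite F0 faces0 in FD.
    by rewrite (bigD1 v vF) /= mevalXU mul0r.
- move=> a u v /asboolP[g [h [Ig Jh] ->]] /asboolP[g' [h' [Ig' Jh'] ->]].
  apply/asboolP; exists (a * g + g'), (a * h + h').
    by split; apply: ideal_gen_lin.
  by rewrite mulrDr addrACA.
Qed.

HB.instance Definition _ := isIdealr.Build _ A_ideal A_ideal_closed.

End ArtinianAlgebra.

Arguments stanley_reisner_ideal K {n} D _.
Arguments squares_ideal K n _.
Arguments A_ideal K {n} D _.

Section WeakLefschetz.
Variables (K : fieldType) (n : nat).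

(* The space of linear forms of K[x_1, ..., x_n], identified with K^n through
   the coefficients. *)
Definition linear_form (c : 'I_n -> K) : {mpoly K[n]} :=
  \sum_(v < n) c v *: 'X_v.

Definition zariski_open (U : set ('I_n -> K)) : Prop :=
  exists S : set {mpoly K[n]},
    U = [set c | exists2 p, S p & p.@[c] != 0].

Variable I : idealr {mpoly K[n]}.

Local Notation A := {ideal_quot I}.

(* The component A_i of the grading of A when I is homogeneous. *)
Definition graded_part (i : nat) : set A :=
  [set \pi_A f | f in [set f : {mpoly K[n]} | f \is i.-homog]].

Definition mult_maximal_rank (l : A) (i : nat) : Prop :=
  set_inj (graded_part i) ( *%R l) \/
  set_surj (graded_part i) (graded_part i.+1) ( *%R l).

Definition has_WLP : Prop :=
  exists2 U : set ('I_n -> K), zariski_open U /\ U !=set0 &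
    forall c, U c -> forall i, mult_maximal_rank (\pi_A (linear_form c)) i.

End WeakLefschetz.

(* Main.v *)
Require Import Defs.
From mathcomp Require Import boolp classical_sets functions.
From mathcomp Require Import all_boot all_order all_algebra ring_quotient.
From mathcomp Require Import mpoly ring zify.

(** The defining ideal of A(D) is monomial, so A(D) has the squarefree monomials
    x_F, F a face, as a basis, and a polynomial is determined modulo the ideal
    by its coefficients on those monomials ([A_idealP]).  When all the
    coefficients of a linear form l = sum c_v x_v are nonzero, rescaling the
    variables turns multiplication by l, from degree i to degree i+1, into the
    map that sends a function h on the faces with i vertices to the function
    F |-> sum over v in F of h(F \ v) on the faces with i+1 vertices.
    Injectivity and surjectivity of the former become the conditions
    [incidence_inj] and [incidence_surj] on D
    ([mult_linear_form_injP], [mult_linear_form_surjP]).  In characteristic 0,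
    every nonempty Zariski-open set of linear forms contains one whose
    coefficients are all nonzero ([zariski_open_torus]), so the WLP is a
    question about incidences of faces.

    For vdw(n,3), the map is injective in degrees 0 and 1, surjective in degree
    3 since each facet p, p+d, p+2d, p+3d is the only one that contains the
    triangle p, p+d, p+3d, and onto 0 in higher degrees.  Everything is decided
    in degree 2.

    - It is never injective there: the weight on edges a, b that depends only on
      the residues mod 4, and equals 1 on the residues {0,1} and {2,3}, -1 on
      {1,2} and {0,3}, and 0 elsewhere, sums to 0 over the edges of every
      triangle ([vdw_incidence_not_inj2]).
    - For n <= 6 only the step d = 1 occurs, and edge weights with prescribed
      sums over the triangles are found by recursion along the vertices
      ([vdw_incidence_surj2]).
    - For n >= 7 the progression 0, 2, 4, 6 is present, and there is a nonzero
      signed combination of triangles in {0,...,6} in which every edge cancels,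
      hence a nonzero functional on degree 3 that vanishes on the image
      ([vdw_incidence_not_surj2]).

    So maximal rank in degree 2 holds exactly when n <= 6. *)

(** * Multiplication by a linear form in face coordinates *)

Section FaceCoefficients.

Set Implicit Arguments.
Import GRing.Theory.
Local Open Scope ring_scope.

Variables (K : fieldType) (n : nat) (D : simplicial_complex n).
Implicit Types (f g : {mpoly K[n]}) (F G : {set 'I_n}) (h : {set 'I_n} -> K).

Lemma prod_mesym1 F : \prod_(v in F) 'X_v = 'X_[mesym1 F] :> {mpoly K[n]}.
Proof.
rewrite mpolyXE_id [LHS]big_mkcond /=; apply: eq_bigr => v _.
by rewrite mnmE; case: (v \in F); rewrite ?expr1 ?expr0.
Qed.

Lemma mesym1_setD1 F (v : 'I_n) : v \in F ->
  mesym1 F = (U_(v) + mesym1 (F :\ v))%MM.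
Proof.
move=> vF; apply/mnmP => i; rewrite !mnmE !inE.
by have [<-|ne] := eqVneq v i; rewrite ?vF ?eqxx // eq_sym (negPf ne).
Qed.

Lemma mcoeffMX_eq0 f (m k : 'X_{1..n}) : ~~ (m <= k)%MM -> (f * 'X_[m])@_k = 0.
Proof.
move=> mk; apply: memN_msupp_eq0; rewrite (perm_mem (msuppMX _ _)).
by apply: contra mk => /mapP[k' _ ->]; rewrite lem_addr.
Qed.

Lemma mcoeff_linear_formM (c : 'I_n -> K) f F :
  (linear_form c * f)@_(mesym1 F) = \sum_(v in F) c v * f@_(mesym1 (F :\ v)).
Proof.
rewrite mulr_suml raddf_sum /= [RHS]big_mkcond /=; apply: eq_bigr => v _.
rewrite -scalerAl mcoeffZ [_ * f]mulrC; case: ifPn => vF.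
  by rewrite (mesym1_setD1 vF) mcoeffMX.
rewrite mcoeffMX_eq0 ?mulr0 //; apply/mnm_lepP => /(_ v).
by rewrite !mnmE eqxx (negPf vF).
Qed.

(** Modulo the defining ideal only the coefficients on the face monomials
    matter: every other monomial has a square factor or a nonface as support. *)
Lemma A_idealP f :
  reflect (forall F, F \in faces D -> f@_(mesym1 F) = 0) (f \in A_ideal K D).
Proof.
apply: (iffP (asboolP _)) => [[g [h [Ig Jh] ->]] F FD|f0].
  have gen0 (G : classical_sets.set {mpoly K[n]}) u :
      (forall p, G p -> forall a, (a * p)@_(mesym1 F) = 0) ->
      ideal_gen G u -> u@_(mesym1 F) = 0.
    move=> G0 [s sG ->]; rewrite raddf_sum big_seq big1 // => p /sG.
    by move=> /G0/(_ p.1).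
  rewrite mcoeffD (gen0 _ _ _ Ig) ?(gen0 _ _ _ Jh) ?addr0 //.
    move=> _ [v ->] a; rewrite mpolyXn mcoeffMX_eq0 //.
    apply/mnm_lepP => /(_ v); rewrite mulmnE !mnmE eqxx.
    by case: (v \in F).
  move=> _ [G GD ->] a; rewrite prod_mesym1 mcoeffMX_eq0 //.
  apply: contra GD => /mnm_lepP GF; apply: faces_sub FD _.
  apply/fintype.subsetP => v vG; have := GF v; rewrite !mnmE vG.
  by case: (v \in F).
(* Conversely, each term of f has a square factor, a nonface as support,
   or a zero coefficient. *)
apply/asboolP; rewrite -[asbool _]/(f \in A_ideal K D) (mpolyE f).
apply: rpred_sum => m _; rewrite -mul_mpolyC.
have [/existsP[v mv]|] := boolP [exists v, (1 < m v)%N].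
  apply/idealMr/asboolP; exists 0, 'X_[m]; last by rewrite add0r.
  split; first exact: ideal_gen0.
  exists [:: ('X_[m - U_(v) *+ 2], 'X_v ^+ 2)] => [p|].
    by rewrite mem_seq1 => /eqP ->; exists v.
  rewrite big_seq1 mpolyXn -mpolyXD submK //; apply/mnm_lepP => i.
  by rewrite mulmnE mnmE; case: eqP => [<-|_].
move=> /existsPn m1; pose F := [set v | m v != 0%N].
have mF : m = mesym1 F.
  by apply/mnmP => v; rewrite mnmE inE; have := m1 v; case: (m v) => [|[]].
have [FD|FD] := boolP (F \in faces D).
  by rewrite mF f0 // mpolyC0 mul0r idealr0.
apply/idealMr/asboolP; exists 'X_[m], 0; last by rewrite addr0.
split; last exact: ideal_gen0.
exists [:: (1, 'X_[m])] => [p|]; last by rewrite big_seq1 mul1r.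
by rewrite mem_seq1 => /eqP ->; exists F; rewrite // prod_mesym1 mF.
Qed.

Local Notation A := {ideal_quot (A_ideal K D)}.
Local Notation pi := (\pi_A)%qT.

Lemma pi_eqP f g :
  reflect (forall F, F \in faces D -> f@_(mesym1 F) = g@_(mesym1 F))
          (pi f == pi g).
Proof.
rewrite -Quotient.idealrBE; apply: (iffP (A_idealP _)) => fg F FD.
  by apply/eqP; rewrite -subr_eq0 -mcoeffB fg.
by rewrite mcoeffB fg ?subrr.
Qed.

Lemma pi_mulP l f g :
  reflect (forall F, F \in faces D -> (l * f)@_(mesym1 F) = g@_(mesym1 F))
          (pi l * pi f == pi g).
Proof. by rewrite -rmorphM; apply: pi_eqP. Qed.

(** The homogeneous polynomial of degree [i] with coefficient [h F] on the
    monomial of each set [F] with [i] elements. *)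
Definition face_form (i : nat) h : {mpoly K[n]} :=
  \sum_(F : {set 'I_n} | #|F| == i) h F *: 'X_[mesym1 F].

Lemma face_form_homog i h : face_form i h \is i.-homog.
Proof.
apply: rpred_sum => F /eqP Fi; apply: rpredZ.
by rewrite dhomogX -Fi; apply/eqP/mdeg_mesym1.
Qed.

Lemma mcoeff_face_form i h F : #|F| = i -> (face_form i h)@_(mesym1 F) = h F.
Proof.
move=> Fi; rewrite raddf_sum (bigD1 F) ?Fi //= mcoeffZ mcoeffX eqxx mulr1.
rewrite big1 ?addr0 // => G /andP[_ GF].
by rewrite mcoeffZ mcoeffX (inj_eq (@inj_mesym1 _)) (negPf GF) mulr0.
Qed.

Lemma mcoeff_homog i f F : f \is i.-homog -> #|F| != i -> f@_(mesym1 F) = 0.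
Proof.
by move=> fi Fi; apply: (dhomog_nemf_coeff fi); rewrite /= mdeg_mesym1.
Qed.

Lemma linear_form_homog (c : 'I_n -> K) : linear_form c \is 1.-homog.
Proof.
by apply: rpred_sum => v _; apply: rpredZ; rewrite dhomogX; apply/eqP/mdeg1.
Qed.

(** Injectivity in degree [i] of the map that sends a function [h] on faces to
    F |-> sum over v in F of h(F \ v).  Functions are taken on all sets of
    vertices; only their values on faces count, because subsets of faces are
    faces. *)
Definition incidence_inj i : Prop := forall h,
  (forall F, F \in faces D -> #|F| = i.+1 -> \sum_(v in F) h (F :\ v) = 0) ->
  forall G, G \in faces D -> #|G| = i -> h G = 0.

(** Surjectivity of the same map onto the functions on the faces with [i.+1]
    vertices. *)
Definition incidence_surj i : Prop := forall g : {set 'I_n} -> K,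
  exists h, forall F, F \in faces D -> #|F| = i.+1 ->
    \sum_(v in F) h (F :\ v) = g F.

Variable c : 'I_n -> K.
Hypothesis c_neq0 : forall v, c v != 0.

(* The coefficient on x_F divided by w F is the coefficient in the rescaled
   variables c_v x_v, whose sum is the linear form. *)
Let w F := \prod_(v in F) c v.

Let w_neq0 F : w F != 0.
Proof. by apply/prodf_neq0. Qed.

Let mcoeff_w f F : (linear_form c * f)@_(mesym1 F) =
  w F * \sum_(v in F) f@_(mesym1 (F :\ v)) / w (F :\ v).
Proof.
rewrite mcoeff_linear_formM mulr_sumr; apply: eq_bigr => v vF.
have -> : w F = c v * w (F :\ v) by rewrite /w (big_setD1 v vF).
by rewrite -mulrA [w _ * _]mulrC mulfVK.
Qed.

Lemma mult_linear_form_injP i :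
  set_inj (graded_part i) ( *%R (pi (linear_form c))) <-> incidence_inj i.
Proof.
split=> [inj h h0 G GD Gi|inj x y].
  pose f := face_form i (fun G => w G * h G).
  have fA : pi f \in (graded_part i : classical_sets.set A).
    by apply/mem_set; exists f => //; apply: face_form_homog.
  have A0 : pi 0 \in (graded_part i : classical_sets.set A).
    by apply/mem_set; exists 0 => //; apply: rpred0.
  have /eqP/pi_eqP/(_ G GD) : pi f = pi 0.
    apply: inj => //; apply/eqP; rewrite -[X in _ == X]rmorphM /=.
    apply/pi_mulP => F FD; rewrite mulr0 mcoeff0.
    have [Fi|Fi] := eqVneq #|F| i.+1; last first.
      apply: mcoeff_homog Fi; rewrite -addn1 addnC.
      by apply: dhomogM; [apply: linear_form_homog|apply: face_form_homog].
    rewrite mcoeff_w (eq_bigr (fun v => h (F :\ v))) ?h0 ?mulr0 // => v vF.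
    rewrite mcoeff_face_form; first by rewrite [w _ * _]mulrC mulfK.
    by move: Fi; rewrite (cardsD1 v) vF => -[].
  rewrite mcoeff_face_form // mcoeff0 => /eqP.
  by rewrite mulf_eq0 (negPf (w_neq0 G)) => /eqP.
move=> /set_mem[f fi <-] /set_mem[g gi <-] eq_fg.
apply/eqP/pi_eqP => G GD.
have [Gi|Gi] := eqVneq #|G| i; last by rewrite !(@mcoeff_homog i).
suff /eqP: (f - g)@_(mesym1 G) / w G = 0.
  by rewrite mulf_eq0 invr_eq0 (negPf (w_neq0 G)) orbF mcoeffB subr_eq0 => /eqP.
apply: (inj (fun G => (f - g)@_(mesym1 G) / w G)) => // F FD Fi.
apply: (mulfI (w_neq0 F)); rewrite -mcoeff_w mulr0 mulrBr mcoeffB.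
apply/eqP; rewrite subr_eq0; apply/eqP; apply/pi_mulP: (F) FD.
by rewrite [X in _ == X]rmorphM /= eq_fg.
Qed.

Lemma mult_linear_form_surjP i :
  set_surj (graded_part i) (graded_part i.+1) ( *%R (pi (linear_form c))) <->
  incidence_surj i.
Proof.
split=> [surj g|surj _ [g gi <-]].
  pose f := face_form i.+1 (fun G => w G * g G).
  have fA : (graded_part i.+1 : classical_sets.set A) (pi f).
    by exists f => //; apply: face_form_homog.
  have [_ [p pi <-] /eqP/pi_mulP pf] := surj _ fA.
  exists (fun G => p@_(mesym1 G) / w G) => F FD Fi.
  by apply: (mulfI (w_neq0 F)); rewrite -mcoeff_w pf // mcoeff_face_form.
have [h hP] := surj (fun G => g@_(mesym1 G) / w G).
pose f := face_form i (fun G => w G * h G).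
have fi := face_form_homog i (fun G => w G * h G).
exists (pi f); first by exists f.
apply/eqP/pi_mulP => F FD; have [Fi|Fi] := eqVneq #|F| i.+1; last first.
  rewrite !(@mcoeff_homog i.+1) // -addn1 addnC.
  by apply: dhomogM; first exact: linear_form_homog.
rewrite mcoeff_w -[RHS](mulfVK (w_neq0 F)) -hP // [RHS]mulrC; congr (_ * _).
apply: eq_bigr => v vF; rewrite mcoeff_face_form.
  by rewrite [w _ * _]mulrC mulfK.
by move: Fi; rewrite (cardsD1 v) vF => -[].
Qed.

End FaceCoefficients.

Arguments mult_linear_form_injP {K n D c}.
Arguments mult_linear_form_surjP {K n D c}.

(** * Faces of the van der Waerden complex as sorted lists *)

Section VdwFaces.

Set Implicit Arguments.
Import GRing.Theory.
Local Open Scope ring_scope.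

Section SortedLists.

Variables (K : fieldType) (n : nat).
Implicit Types (a b c d : 'I_n) (s : seq 'I_n) (h : {set 'I_n} -> K).

(** The increasing list of the elements of [F], as natural numbers. *)
Definition code (F : {set 'I_n}) : seq nat := [seq val v | v <- enum F].

Lemma code_set s : sorted ltn (map val s) -> code [set:: s] = map val s.
Proof.
move=> s_sorted; apply: (irr_sorted_eq ltn_trans ltnn) => //.
  apply: (subseq_sorted ltn_trans) (iota_ltn_sorted 0 n).
  by rewrite -val_enum_ord map_subseq // {1}/enum_mem -enumT filter_subseq.
move=> x; apply/mapP/mapP => -[v vs ->]; exists v => //.
  by move: vs; rewrite mem_enum inE.
by rewrite mem_enum inE.
Qed.

Lemma card_set_seq s : uniq s -> #|[set:: s]| = size s.
Proof. by move=> s_uniq; rewrite cardsE; apply/card_uniqP. Qed.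

Lemma sum_setD1_seq h s : uniq s ->
  \sum_(v in [set:: s]) h ([set:: s] :\ v) = \sum_(v <- s) h [set:: rem v s].
Proof.
move=> s_uniq; rewrite big_uniq //=; apply: eq_big => v; first by rewrite inE.
move=> _; congr h; apply/setP => x.
by rewrite !inE mem_rem_uniq ?inE.
Qed.

Lemma sum_set2 h a b : (a < b)%N ->
  \sum_(v in [set:: [:: a; b]]) h ([set:: [:: a; b]] :\ v) =
  h [set:: [:: b]] + h [set:: [:: a]].
Proof.
move=> ab; have /negPf nab : a != b by rewrite -val_eqE neq_ltn ab.
by rewrite sum_setD1_seq /= ?inE ?nab // !big_cons big_nil /= !eqxx nab addr0.
Qed.

Lemma sum_set3 h a b c : (a < b)%N -> (b < c)%N ->
  \sum_(v in [set:: [:: a; b; c]]) h ([set:: [:: a; b; c]] :\ v) =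
  h [set:: [:: b; c]] + h [set:: [:: a; c]] + h [set:: [:: a; b]].
Proof.
move=> ab bc; have ac := ltn_trans ab bc.
have /negPf nab : a != b by rewrite -val_eqE neq_ltn ab.
have /negPf nac : a != c by rewrite -val_eqE neq_ltn ac.
have /negPf nbc : b != c by rewrite -val_eqE neq_ltn bc.
rewrite sum_setD1_seq /= ?inE ?nab ?nac ?nbc // !big_cons big_nil /=.
by rewrite !eqxx nab nac nbc addr0 addrA.
Qed.

Lemma sum_set4 h a b c d : (a < b)%N -> (b < c)%N -> (c < d)%N ->
  \sum_(v in [set:: [:: a; b; c; d]]) h ([set:: [:: a; b; c; d]] :\ v) =
  h [set:: [:: b; c; d]] + h [set:: [:: a; c; d]] +
  h [set:: [:: a; b; d]] + h [set:: [:: a; b; c]].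
Proof.
move=> ab bc cd; have [ac bd] := (ltn_trans ab bc, ltn_trans bc cd).
have ad := ltn_trans ab bd.
have /negPf nab : a != b by rewrite -val_eqE neq_ltn ab.
have /negPf nac : a != c by rewrite -val_eqE neq_ltn ac.
have /negPf nad : a != d by rewrite -val_eqE neq_ltn ad.
have /negPf nbc : b != c by rewrite -val_eqE neq_ltn bc.
have /negPf nbd : b != d by rewrite -val_eqE neq_ltn bd.
have /negPf ncd : c != d by rewrite -val_eqE neq_ltn cd.
rewrite sum_setD1_seq /= ?inE ?nab ?nac ?nad ?nbc ?nbd ?ncd //.
by rewrite !big_cons big_nil /= !eqxx nab nac nad nbc nbd ncd addr0 !addrA.
Qed.

End SortedLists.

(** The vertices [p], [q], [r], [t] form, in this order, a progression of
    step [d]. *)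
Definition prog4 (n d : nat) (p q r t : 'I_n) : Prop :=
  [/\ (0 < d)%N, q = (p + d)%N :> nat, r = (p + 2 * d)%N :> nat
    & t = (p + 3 * d)%N :> nat].

Section Progressions.

Variable n : nat.
Implicit Types (p q r t : 'I_n) (F : {set 'I_n}).

Lemma prog4_lt d p q r t : prog4 d p q r t ->
  [/\ (p < q)%N, (q < r)%N & (r < t)%N].
Proof. by case=> *; split; lia. Qed.

Lemma prog4E d p q r t : prog4 d p q r t ->
  progression n 3 p d = [set:: [:: p; q; r; t]].
Proof.
case=> d0 qE rE tE; apply/setP => x; rewrite !inE -!val_eqE /= qE rE tE.
apply/existsP/idP => [[[j j4] /= /eqP->]|].
  by case: j j4 => [|[|[|[|]]]] // _; rewrite ?mul0n ?addn0 ?mul1n eqxx ?orbT.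
case/or4P => /eqP->; [exists 0|exists 1|exists (inord 2)|exists (inord 3)].
- by rewrite addn0.
- by rewrite mul1n.
- by rewrite inordK.
- by rewrite inordK.
Qed.

Lemma card_mask_prog4 (m : bitseq) d p q r t : prog4 d p q r t ->
  #|[set:: mask m [:: p; q; r; t]]| = size (mask m [:: p; q; r; t]).
Proof.
move=> pqrt; have [_ qE rE tE] := pqrt.
apply: card_set_seq; apply: mask_uniq.
by case: pqrt => d0 *; rewrite /= !inE -!val_eqE /=; lia.
Qed.

(** A face is selected from a four-term progression by the membership bits of
    the four terms. *)
Lemma vdw_faceP F : F \in vdw_faces n 3 ->
  exists d p q r t (m0 m1 m2 m3 : bool), prog4 d p q r t /\
    F = [set:: mask [:: m0; m1; m2; m3] [:: p; q; r; t]].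
Proof.
rewrite inE => /exists_inP[G]; rewrite inE => /existsP[p /existsP[d]].
case/and3P=> d0 pd /eqP -> FG.
have lt1 : (p + d < n)%N by lia.
have lt2 : (p + 2 * d < n)%N by lia.
pose q := Ordinal lt1; pose r := Ordinal lt2; pose t := Ordinal pd.
have pqrt : prog4 d p q r t by [].
exists d, p, q, r, t, (p \in F), (q \in F), (r \in F), (t \in F); split=> //.
rewrite -[[:: p \in F; _; _; _]]/(map (mem F) [:: p; q; r; t]) -filter_mask.
apply/setP => x; rewrite in_set mem_filter /=.
have [xF|//] := boolP (x \in F).
by have := fintype.subsetP FG x xF; rewrite (prog4E pqrt) in_set => ->.
Qed.

Lemma vdw_face d p q r t s : prog4 d p q r t ->
  {subset s <= [:: p; q; r; t]} -> [set:: s] \in vdw_faces n 3.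
Proof.
move=> pqrt s_sub; rewrite inE; apply/exists_inP.
exists (progression n 3 p d); last first.
  rewrite (prog4E pqrt); apply/fintype.subsetP => x.
  by rewrite !inE => /s_sub; rewrite !inE.
case: (pqrt) => d0 qE rE tE; have tn := ltn_ord t.
have dn : (d < n)%N by lia.
rewrite inE; apply/existsP; exists p; apply/existsP; exists (Ordinal dn) => /=.
by rewrite d0 eqxx andbT; lia.
Qed.

Lemma card_vdw_face F : F \in vdw_faces n 3 -> (#|F| <= 4)%N.
Proof.
case/vdw_faceP => d [p [q [r [t [m0 [m1 [m2 [m3 [pqrt ->]]]]]]]]].
by rewrite (card_mask_prog4 _ pqrt); case: m0 m1 m2 m3 => [] [] [] [].
Qed.

Lemma vdw_face1P F : F \in vdw_faces n 3 -> #|F| = 1 ->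
  exists d p q r t, prog4 d p q r t /\
    [\/ F = [set:: [:: p]], F = [set:: [:: q]],
        F = [set:: [:: r]] | F = [set:: [:: t]]].
Proof.
case/vdw_faceP => d [p [q [r [t [m0 [m1 [m2 [m3 [pqrt ->]]]]]]]]].
rewrite (card_mask_prog4 _ pqrt) => Fc; exists d, p, q, r, t; split=> //.
by case: m0 m1 m2 m3 Fc => [] [] [] [] //= _;
  [constructor 1|constructor 2|constructor 3|constructor 4].
Qed.

Lemma vdw_face3P F : F \in vdw_faces n 3 -> #|F| = 3 ->
  exists d p q r t, prog4 d p q r t /\
    [\/ F = [set:: [:: p; q; r]], F = [set:: [:: p; q; t]],
        F = [set:: [:: p; r; t]] | F = [set:: [:: q; r; t]]].
Proof.
case/vdw_faceP => d [p [q [r [t [m0 [m1 [m2 [m3 [pqrt ->]]]]]]]]].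
rewrite (card_mask_prog4 _ pqrt) => Fc; exists d, p, q, r, t; split=> //.
by case: m0 m1 m2 m3 Fc => [] [] [] [] //= _;
  [constructor 1|constructor 2|constructor 3|constructor 4].
Qed.

Lemma vdw_face4P F : F \in vdw_faces n 3 -> #|F| = 4 ->
  exists d p q r t, prog4 d p q r t /\ F = [set:: [:: p; q; r; t]].
Proof.
case/vdw_faceP => d [p [q [r [t [m0 [m1 [m2 [m3 [pqrt ->]]]]]]]]].
rewrite (card_mask_prog4 _ pqrt) => Fc; exists d, p, q, r, t; split=> //.
by case: m0 m1 m2 m3 Fc => [] [] [] [].
Qed.

End Progressions.
End VdwFaces.

(** * Incidence maps of the van der Waerden complex *)

Section VdwIncidence.

Set Implicit Arguments.
Import GRing.Theory.
Local Open Scope ring_scope.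

Variables (K : fieldType) (n : nat) (hn : (0 < 3 < n)%N).
Hypothesis charK : [pchar K] =i pred0.

Local Notation D := (@vdw n 3 hn).
Implicit Types (F G : {set 'I_n}) (h g : {set 'I_n} -> K).

Let two_neq0 : 2%:R != 0 :> K.
Proof. by have /pcharf0P -> := charK. Qed.

Let face d p q r t s : prog4 d p q r t ->
  {subset s <= [:: p; q; r; t]} -> [set:: s] \in faces D.
Proof. exact: vdw_face. Qed.

Let exists_prog4 : exists p q r t : 'I_n, p = 0%N :> nat /\ prog4 1 p q r t.
Proof.
have n3 : (3 < n)%N := hn.
have [n0 n1 n2] : [/\ (0 < n)%N, (1 < n)%N & (2 < n)%N] by split; lia.
by exists (Ordinal n0), (Ordinal n1), (Ordinal n2), (Ordinal n3); split.
Qed.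

Lemma vdw_incidence_inj0 : incidence_inj K D 0.
Proof.
move=> h h0 G _ /eqP; rewrite cards_eq0 => /eqP->.
have [p [q [r [t [p0 pqrt]]]]] := exists_prog4.
have pD : [set p] \in faces D.
  rewrite -set_seq1; apply: face pqrt _ => x.
  by rewrite !inE => /eqP->; rewrite eqxx.
by have := h0 _ pD (cards1 p); rewrite big_set1 setDv.
Qed.

Let sum_edge h d p q r t (a b : 'I_n) : prog4 d p q r t ->
    (forall F, F \in faces D -> #|F| = 2 -> \sum_(v in F) h (F :\ v) = 0) ->
    a \in [:: p; q; r; t] -> b \in [:: p; q; r; t] -> (a < b)%N ->
  h [set:: [:: a]] + h [set:: [:: b]] = 0.
Proof.
move=> pqrt h0 am bm ab; rewrite addrC -sum_set2 //; apply: h0.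
  apply: face pqrt _ => x; rewrite inE mem_seq1.
  by move=> /orP[] /eqP->.
by rewrite card_set_seq //= inE -val_eqE neq_ltn ab.
Qed.

(** Every vertex lies in a triangle of the complex, and the three edge equations
    of a triangle give 2 h = 0 at each of its vertices. *)
Lemma vdw_incidence_inj1 : incidence_inj K D 1.
Proof.
move=> h h0 G /vdw_face1P GD /GD[d [p [q [r [t [pqrt]]]]]].
have [pq qr rt] := prog4_lt pqrt.
pose e a b := @sum_edge h d p q r t a b pqrt h0.
have zero a b c : a + b = 0 -> b + c = 0 -> a + c = 0 -> a = 0 :> K.
  move=> ab bc ac; apply/eqP.
  rewrite -(mulrI_eq0 _ (mulfI two_neq0)).
  have -> : 2%:R * a = (a + b) + (a + c) - (b + c) by ring.
  by rewrite ab bc ac addr0 subr0.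
have [pr qt] := (ltn_trans pq qr, ltn_trans qr rt).
have epq : h [set:: [:: p]] + h [set:: [:: q]] = 0.
  by apply: e; rewrite ?inE ?eqxx ?orbT.
have epr : h [set:: [:: p]] + h [set:: [:: r]] = 0.
  by apply: e; rewrite ?inE ?eqxx ?orbT.
have eqr : h [set:: [:: q]] + h [set:: [:: r]] = 0.
  by apply: e; rewrite ?inE ?eqxx ?orbT.
have eqt : h [set:: [:: q]] + h [set:: [:: t]] = 0.
  by apply: e; rewrite ?inE ?eqxx ?orbT.
have ert : h [set:: [:: r]] + h [set:: [:: t]] = 0.
  by apply: e; rewrite ?inE ?eqxx ?orbT.
case=> ->.
- exact: zero epq eqr epr.
- exact: zero eqr ert eqt.
- by apply: zero ert _ _; rewrite addrC; [exact: eqt|exact: eqr].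
- by apply: zero _ eqr _; rewrite addrC; [exact: eqt|exact: ert].
Qed.

(** A symmetric edge weight that depends only on residues mod 4: 1 on {0,1} and
    {2,3}, -1 on {1,2} and {0,3}, and 0 on residues of the same parity. *)
Definition mod4_weight (a b : nat) : K :=
  let e := ((a %% 4)%N, (b %% 4)%N) in
  if e \in [:: (0, 1); (1, 0); (2, 3); (3, 2)]%N then 1
  else if e \in [:: (1, 2); (2, 1); (0, 3); (3, 0)]%N then -1 else 0.

Lemma mod4_weight_triangle (a b c p d : nat) :
  (a, b, c) \in [:: (p, p + d, p + 2 * d); (p, p + d, p + 3 * d);
      (p, p + 2 * d, p + 3 * d); (p + d, p + 2 * d, p + 3 * d)]%N ->
  mod4_weight b c + mod4_weight a c + mod4_weight a b = 0.
Proof.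
have E m : ((p + m * d) %% 4 = (p %% 4 + m * (d %% 4)) %% 4)%N.
  by rewrite modnDml -modnDmr -modnMmr modnDmr.
have := E 1%N; rewrite !mul1n => E1.
rewrite !inE !xpair_eqE /mod4_weight.
case/or4P=> /andP[/andP[/eqP-> /eqP->] /eqP->]; rewrite ?E ?E1.
all: move: (p %% 4)%N (d %% 4)%N
       (ltn_pmod p (isT : 0 < 4)%N) (ltn_pmod d (isT : 0 < 4)%N).
all: by move=> [|[|[|[|?]]]] [|[|[|[|?]]]] //= _ _; ring.
Qed.

Lemma vdw_incidence_not_inj2 : ~ incidence_inj K D 2.
Proof.
move=> inj; have [p [q [r [t [p0 pqrt]]]]] := exists_prog4.
pose h G := if code G is [:: a; b] then mod4_weight a b else 0.
have hE (a b : 'I_n) : (a < b)%N -> h [set:: [:: a; b]] = mod4_weight a b.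
  by move=> ab; rewrite /h code_set //= ab.
have [pq _ _] := prog4_lt pqrt.
have : h [set:: [:: p; q]] = 0.
  apply: inj; last 1 first.
  - by rewrite card_set_seq //= inE -val_eqE neq_ltn pq.
  - move=> F /vdw_face3P FD /FD [d [a [b [c [e [abce FE]]]]]].
    have [ab bc ce] := prog4_lt abce; have [_ bE cE eE] := abce.
    have [ac be] := (ltn_trans ab bc, ltn_trans bc ce).
    have ae := ltn_trans ac ce.
    case: FE => ->; rewrite sum_set3 // !hE //;
      apply: (@mod4_weight_triangle _ _ _ a d);
      by rewrite ?bE ?cE ?eE !inE eqxx ?orbT.
  - apply: face pqrt _ => x; rewrite inE mem_seq1 => /orP[] /eqP->;
    by rewrite !inE eqxx ?orbT.
have [_ qE _ _] := pqrt; rewrite hE // qE p0 => /eqP.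
by rewrite /mod4_weight /= oner_eq0.
Qed.

(** A facet is the only one to contain its first, second and fourth vertices,
    which have gaps d and 2d; the preimage is supported on such triangles. *)
Lemma vdw_incidence_surj3 : incidence_surj K D 3.
Proof.
move=> g.
pose h G := if code G is [:: a; b; c] then
  if c == (a + 3 * (b - a))%N then g (progression n 3 a (b - a)) else 0 else 0.
exists h => F /vdw_face4P FD /FD [d [p [q [r [t [pqrt ->]]]]]].
have [pq qr rt] := prog4_lt pqrt; rewrite sum_set4 //.
have [pr qt] := (ltn_trans pq qr, ltn_trans qr rt).
have [d0 qE rE tE] := pqrt.
rewrite /h !code_set /= ?pq ?qr ?rt ?pr ?qt //.
have /negPf -> : t != (q + 3 * (r - q))%N :> nat by lia.
have /negPf -> : t != (p + 3 * (r - p))%N :> nat by lia.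
have /negPf -> : r != (p + 3 * (q - p))%N :> nat by lia.
have -> : (q - p = d)%N by lia.
by rewrite tE eqxx (prog4E pqrt) addr0 !add0r.
Qed.

Lemma vdw_incidence_surj_ge4 i : (4 <= i)%N -> incidence_surj K D i.
Proof.
move=> i4 g; exists g => F /card_vdw_face F4 Fi.
by rewrite Fi ltnNge i4 in F4.
Qed.

(** The weight of the edge {a, a+1} in the preimage of [g] under the degree 2
    incidence map when all progressions have step 1.  Eliminating the weights of
    {a, a+2} and {a, a+3} from the equations of the four triangles in
    a, ..., a+3 leaves one equation, for twice the difference between the
    weights of {a+2, a+3} and {a, a+1}. *)
Fixpoint edge_weight (g : seq nat -> K) (a : nat) : K :=
  if a is b.+2 then
    edge_weight g b +
    (g [:: b; b.+2; b.+3] - g [:: b; b.+1; b.+3] - g [:: b; b.+1; b.+2]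
     + g [:: b.+1; b.+2; b.+3]) / 2%:R
  else 0.

Lemma vdw_incidence_surj2 : (n <= 6)%N -> incidence_surj K D 2.
Proof.
move=> n6 g.
(* E, B and C are the weights of the edges of lengths 1, 2 and 3; B solves the
   equation of {a, a+1, a+2}, and C that of {a, a+1, a+3}. *)
pose gc (s : seq nat) := g [set v | val v \in s].
pose E := edge_weight gc.
pose B a := gc [:: a; a.+1; a.+2] - E a - E a.+1.
pose C a := gc [:: a; a.+1; a.+3] - E a - B a.+1.
pose e a b := if b == a.+1 then E a else if b == a.+2 then B a else C a.
pose h G := if code G is [:: a; b] then e a b else 0.
have hE (a b : 'I_n) : (a < b)%N -> h [set:: [:: a; b]] = e a b.
  by move=> ab; rewrite /h code_set //= ab.
exists h => F /vdw_face3P FD /FD [d [p [q [r [t [pqrt FE]]]]]].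
have [pq qr rt] := prog4_lt pqrt.
have [pr qt] := (ltn_trans pq qr, ltn_trans qr rt).
have pt := ltn_trans pr rt.
have [d0 qE rE tE] := pqrt.
(* A step of 2 would need 7 vertices. *)
have d1 : d = 1%N by have := ltn_ord t; lia.
have {}qE : q = p.+1 :> nat by lia.
have {}rE : r = p.+2 :> nat by lia.
have {}tE : t = p.+3 :> nat by lia.
have gE (s : seq 'I_n) : g [set:: s] = gc (map val s).
  by congr g; apply/setP => x; rewrite !inE mem_map //; apply: val_inj.
have e1 a : e a a.+1 = E a by rewrite /e eqxx.
have e2 a : e a a.+2 = B a.
  by rewrite /e eqxx; have /negPf -> : a.+2 != a.+1 by lia.
have e3 a : e a a.+3 = C a.
  rewrite /e; have /negPf -> : a.+3 != a.+1 by lia.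
  by have /negPf -> : a.+3 != a.+2 by lia.
have ES a : E a.+2 = E a + (gc [:: a; a.+2; a.+3] - gc [:: a; a.+1; a.+3]
    - gc [:: a; a.+1; a.+2] + gc [:: a.+1; a.+2; a.+3]) / 2%:R by [].
case: FE => ->; rewrite sum_set3 // !hE // gE /= ?qE ?rE ?tE ?e1 ?e2 ?e3.
- by rewrite /B; ring.
- by rewrite /C /B; ring.
- by rewrite /C /B ES; field.
- by rewrite /B; ring.
Qed.

(** The function equal to 1 on {0,1,2} and to 0 on the other triangles is not
    in the image. *)
Lemma vdw_incidence_not_surj2 : (7 <= n)%N -> ~ incidence_surj K D 2.
Proof.
move=> n7 surj.
(* The vertex k, for k < 7. *)
pose o := insubd (Ordinal (leq_trans (isT : 0 < 7)%N n7)).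
have oE k : (k < 7)%N -> o k = k :> nat.
  by move=> k7; rewrite val_insubd (leq_trans k7 n7).
have [h hP] := surj (fun F => (code F == [:: 0; 1; 2]%N)%:R).
pose e a b := h [set:: [:: o a; o b]].
pose z a b c := e b c + e a c + e a b.
have zE p d a b c : [&& 0 < d, p + 3 * d < 7, a < b, b < c &
    all (mem [:: p; p + d; p + 2 * d; p + 3 * d]) [:: a; b; c]]%N ->
  z a b c = ([:: a; b; c] == [:: 0; 1; 2]%N)%:R.
  case/and5P=> d0 pd ab bc /allP abc_sub.
  have c7 : (c < 7)%N.
    have := abc_sub c; rewrite !inE eqxx !orbT => /(_ isT).
    by case/or4P=> /eqP->; lia.
  have pqrt : prog4 d (o p) (o (p + d)) (o (p + 2 * d)) (o (p + 3 * d)).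
    by split; rewrite ?oE; lia.
  have oab : (o a < o b)%N by rewrite !oE; lia.
  have obc : (o b < o c)%N by rewrite !oE; lia.
  rewrite /z /e -sum_set3 // hP.
  - by rewrite code_set /= ?oab ?obc // !oE //; lia.
  - apply: face pqrt _ => x.
    rewrite -[[:: o a; _; _]]/(map o [:: a; b; c]) => /mapP[y /abc_sub ym ->].
    exact: (map_f o ym).
  - by rewrite card_set_seq //= !inE -!val_eqE /=; lia.
(* Every edge occurs equally often on both sides, but {0,1,2} occurs only on
   the left. *)
have : z 0 1 2 + z 0 2 3 + z 1 3 4 + z 2 4 5 + z 3 5 6 + z 2 4 6 + z 0 4 6
     = z 4 5 6 + z 0 1 3 + z 1 2 4 + z 2 3 5 + z 3 4 6 + z 0 2 4 + z 0 2 6.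
  by rewrite /z; ring.
rewrite (zE 0 1 0 1 2)%N // (zE 0 1 0 2 3)%N // (zE 1 1 1 3 4)%N //.
rewrite (zE 2 1 2 4 5)%N // (zE 3 1 3 5 6)%N // (zE 0 2 2 4 6)%N //.
rewrite (zE 0 2 0 4 6)%N // (zE 3 1 4 5 6)%N // (zE 0 1 0 1 3)%N //.
rewrite (zE 1 1 1 2 4)%N // (zE 2 1 2 3 5)%N // (zE 3 1 3 4 6)%N //.
rewrite (zE 0 2 0 2 4)%N // (zE 0 2 0 2 6)%N // /= !mulr0n !addr0 => /eqP.
by rewrite oner_eq0.
Qed.

End VdwIncidence.

(** * Linear forms with nonzero coefficients *)

Section GenericPoint.

Set Implicit Arguments.
Import GRing.Theory.
Local Open Scope ring_scope.

Variables (K : fieldType) (n : nat).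
Hypothesis charK : [pchar K] =i pred0.

Lemma exists_nonroot (q : {poly K}) : q != 0 -> exists t, q.[t] != 0.
Proof.
move=> q0; have natK m : (m%:R == 0 :> K) = (m == 0%N).
  by have /pcharf0P := charK; apply.
have natK_inj : injective (fun m : nat => m%:R : K).
  move=> a b /eqP; wlog ab : a b / (a <= b)%N => [H|].
    by case/orP: (leq_total a b) => ab E; [|apply/esym]; apply: H;
      rewrite // eq_sym.
  rewrite eq_sym -subr_eq0 -natrB // natK subn_eq0 => ba.
  by apply/eqP; rewrite eqn_leq ab.
pose rs : seq K := [seq m%:R | m <- iota 0 (size q)].
have : ~~ all (root q) rs.
  apply/negP => /(max_poly_roots q0).
  by rewrite map_inj_uniq // iota_uniq size_map size_iota ltnn => /(_ isT).
by case/allPn=> t _ qt; exists t.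
Qed.

Lemma horner_mmap_line (c0 : 'I_n -> K) (p : {mpoly K[n]}) t :
  (mmap polyC (fun v => (c0 v)%:P + 'X) p).[t] = p.@[fun v => c0 v + t].
Proof.
rewrite /meval /mmap horner_sum; apply: eq_bigr => m _.
rewrite hornerCM /mmap1 horner_prod; congr (_ * _); apply: eq_bigr => v _.
by rewrite horner_exp hornerD hornerC hornerX.
Qed.

(** On the line c0 + t (1,...,1), the product of a polynomial that does not
    vanish at c0 with all the coordinates is a nonzero polynomial in t. *)
Lemma zariski_open_torus (U : classical_sets.set ('I_n -> K)) (c0 : 'I_n -> K) :
  zariski_open U -> U c0 -> exists2 c, U c & forall v, c v != 0.
Proof.
case=> S -> [p Sp pc0].
pose line v := (c0 v)%:P + 'X : {poly K}.
pose q := mmap polyC line p * \prod_v line v.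
have line_neq0 v : line v != 0 by rewrite /line addrC -size_poly_eq0 size_XaddC.
have q_neq0 : q != 0.
  rewrite mulf_neq0 //; last by apply/prodf_neq0.
  apply: contraNneq pc0 => p0; have := horner_mmap_line c0 p 0.
  by rewrite p0 horner0 => ->; apply/eqP/meval_eq => v; rewrite addr0.
have [t] := exists_nonroot _ q_neq0.
rewrite hornerM mulf_eq0 negb_or horner_mmap_line horner_prod => /andP[pt].
move=> /prodf_neq0 lt0; exists (fun v => c0 v + t); first by exists p.
by move=> v; have := lt0 v isT; rewrite hornerD hornerC hornerX.
Qed.

Lemma zariski_open_torus_set :
  zariski_open [set c : 'I_n -> K | forall v, c v != 0]%classic.
Proof.
exists [set \prod_v 'X_v]%classic; apply/classical_sets.seteqP; split=> c /=.
  move=> c0; exists (\prod_v 'X_v) => //; rewrite rmorph_prod.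
  by apply/prodf_neq0 => v _; rewrite /= mevalXU.
case=> _ ->; rewrite rmorph_prod => /prodf_neq0 c0 v.
by have := c0 v isT; rewrite /= mevalXU.
Qed.

End GenericPoint.

Theorem theorem1p2 (K : fieldType) (n : nat)
    (charK : [pchar K]%R =i pred0) (hn : (3 < n)%N) :
  has_WLP (A_ideal K (@vdw n 3 hn)) <-> n = 4 \/ n = 5 \/ n = 6.
Proof.
split=> [[U [openU [c0 Uc0]] wlp]|n456].
  have [c Uc c_neq0] := zariski_open_torus charK _ openU Uc0.
  suff : ~ (7 <= n)%N by lia.
  move=> n7; case: (wlp c Uc 2%N).
    by move/(mult_linear_form_injP c_neq0); apply: vdw_incidence_not_inj2.
  by move/(mult_linear_form_surjP c_neq0); apply: vdw_incidence_not_surj2.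
exists [set c : 'I_n -> K | forall v, (c v != 0)%R]%classic.
  split; first exact: zariski_open_torus_set.
  by exists (fun _ => 1%R) => v /=; apply: GRing.oner_neq0.
move=> c /= c_neq0 [|[|[|[|i]]]].
- by left; apply/(mult_linear_form_injP c_neq0)/vdw_incidence_inj0.
- by left; apply/(mult_linear_form_injP c_neq0)/vdw_incidence_inj1.
- right; apply/(mult_linear_form_surjP c_neq0)/vdw_incidence_surj2 => //.
  by lia.
- by right; apply/(mult_linear_form_surjP c_neq0)/vdw_incidence_surj3.
- by right; apply/(mult_linear_form_surjP c_neq0)/vdw_incidence_surj_ge4.
Qed.
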